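(* Consider a four-node branch with $a_{21}^0=a_{32}^0=a_{43}^0=a$, $a\in\mathbb R\setminus\{0\}$, which is uniformly excited, i.e. $\sigma_i^2=\sigma^2>0$ for all excited nodes and $\lambda_j=\lambda>0$ for all measured nodes (same $\sigma^2,\lambda$ for all patterns below). Let $P^{\mathrm{I}},P^{\mathrm{II}},P^{\mathrm{III}},P^{\mathrm{IV}}$ be the asymptotic covariance matrices of the estimates of $(a_{21},a_{32},a_{43})$ under the four excitation and measurement patterns (I) $\mathcal B=\{1,3\},\ \mathcal C=\{2,4\}$; (II) $\mathcal B=\{1,2\},\ \mathcal C=\{3,4\}$; (III) $\mathcal B=\{1,2,3\},\ \mathcal C=\{4\}$; (IV) $\mathcal B=\{1\},\ \mathcal C=\{2,3,4\}$. Then pattern (II) yields the smallest trace of the covariance matrix: $\mathrm{tr}(P^{\mathrm{II}})<\mathrm{tr}(P^{j})$ for $j\in\{\mathrm{I},\mathrm{III},\mathrm{IV}\}$.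
   Context: A dynamic network with $n$ nodes is $w(t)=G^0(q)w(t)+Br(t)$, $y(t)=Cw(t)+e(t)$, $t\in\mathbb Z$, where $q$ is the forward shift operator ($qr(t)=r(t+1)$), $w(t)\in\mathbb R^n$ are the node signals, $r$ the external excitations, $y$ the measured outputs, $e$ the measurement noise. $B$ and $C$ are binary selection matrices; $\mathcal B$ is the set of nodes $i$ to which an external signal $r_i$ is applied, and $\mathcal C$ is the set of nodes $j$ that are measured, $y_j=w_j+e_j$. The pair $(\mathcal B,\mathcal C)$ is called an excitation and measurement pattern (EMP). The four-node branch has $G^0(q)=q^{-1}A^0$ where the only nonzero entries of $A^0\in\mathbb R^{4\times 4}$ are $a_{21}^0,a_{32}^0,a_{43}^0$, i.e. $w_1(t)=r_1(t)$ and $w_{i+1}(t)=a_{i+1,i}^0w_i(t-1)+r_{i+1}(t)$ for $i=1,2,3$, with $r_i\equiv0$ if $i\notin\mathcal B$. Assumptions: the $r_i$, $i\in\mathcal B$, are mutually independent stationary zero-mean white noise processes with variances $\sigma_i^2>0$, uncorrelated with the noises; the $e_j$, $j\in\mathcal C$, are independent stationary Gaussian zero-mean white noise processes with variances $\lambda_j>0$. For a parameter vector $\theta=(a_{21},a_{32},a_{43})$ (estimated as three independent parameters), let $G(q,\theta)$ be the network matrix with $a_{ij}$ in place of $a_{ij}^0$. The optimal one-step-ahead predictor is $\hat y(t|t-1;\theta)=C(I-G(q,\theta))^{-1}Br(t)$. Let $\psi(t)$ be the $3\times|\mathcal C|$ matrix whose entry in the row of parameter $\theta_k$ and column of output $j\in\mathcal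 C$ is $\partial \hat y_j(t|t-1;\theta)/\partial\theta_k$ evaluated at the true parameter, and $\Lambda=\mathrm{diag}(\lambda_j)_{j\in\mathcal C}$. The asymptotic covariance matrix of the EMP is $P=[\mathbb E\,\psi(t)\Lambda^{-1}\psi(t)^T]^{-1}$. *)

(* Defs.v *)
From HB Require Import structures.
From mathcomp Require Import all_boot all_order all_algebra.
From mathcomp Require Import all_classical all_reals all_analysis.

Set Implicit Arguments.
Unset Strict Implicit.
Unset Printing Implicit Defensive.

Import Order.TTheory GRing.Theory Num.Theory.
Import numFieldNormedType.Exports.

Local Open Scope classical_set_scope.
Local Open Scope ring_scope.

Section Processes.
Context (R : realType) (d : measure_display) (T : measurableType d)
  (P : probability T R).

(* A finite mean and a finite variance force square integrability, so this is
   wide-sense stationary, zero-mean, serially uncorrelated noise. *)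
Definition white_noise (X : int -> {RV P >-> R}) (v : R) : Prop :=
  [/\ forall t, ('E_P[X t] = 0)%E,
      forall t, ('V_P[X t] = v%:E)%E &
      forall t s, t != s -> covariance P (X t) (X s) = 0%E].

(* All finite linear combinations are normal.  The degenerate normal law is
   spelled out because normal_prob m 0 is not the Dirac mass at m. *)
Definition gaussian_process (X : int -> {RV P >-> R}) : Prop :=
  forall (n : nat) (ts : 'I_n -> int) (c : 'I_n -> R),
  exists m s : R, 0 <= s /\
    forall A : set R, measurable A ->
      P ((fun o => \sum_i c i * X (ts i) o) @^-1` A) =
      if s == 0 then \d_m A else normal_prob m s A.

Definition process_events (X : int -> {RV P >-> R}) : set (set T) :=
  <<s [set A | exists t, preimage_set_system setT (X t) measurable A] >>.

(* Some of the A i may be setT, so this is the product rule over every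
   subfamily. *)
Definition independent_processes (I : finType) (X : I -> int -> {RV P >-> R}) :
    Prop :=
  forall A : I -> set T, (forall i, process_events (X i) (A i)) ->
    P (\bigcap_i A i) = (\prod_i P (A i))%E.

Definition uncorrelated_processes (X Y : int -> {RV P >-> R}) : Prop :=
  forall t s, covariance P (X t) (Y s) = 0%E.

End Processes.

Section Networks.
Variable R : realType.

(* Transfer matrices are matrices over {poly R} whose indeterminate 'X stands
   for the delay q^-1. *)
Definition tf_apply (m n : nat) (G : 'M[{poly R}]_(m, n))
    (u : int -> 'cV[R]_n) (t : int) : 'cV[R]_m :=
  \col_i \sum_j \sum_(k < size (G i j)) (G i j)`_k * u (t - k%:Z) j 0.

(* #|B| columns; column k is the unit vector of the k-th element of B. *)
Definition excitation_mx (n : nat) (B : {set 'I_n}) : 'M[R]_(n, #|B|) :=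
  \matrix_(i, k) (i == enum_val k)%:R.

Definition measurement_mx (n : nat) (C : {set 'I_n}) : 'M[R]_(#|C|, n) :=
  \matrix_(k, i) (i == enum_val k)%:R.

(* The inverse is taken over {poly R}: it is meaningful when \det (1 - G) is a
   nonzero constant, as in branch_tf_unit below. *)
Definition predictor_tf (n : nat) (G : 'M[{poly R}]_n) (B C : {set 'I_n}) :
    'M[{poly R}]_(#|C|, #|B|) :=
  map_mx polyC (measurement_mx C) *m invmx (1%:M - G)
    *m map_mx polyC (excitation_mx B).

Record experiment (n : nat) (G0 : 'M[{poly R}]_n) (B C : {set 'I_n})
    (sigma2 : 'I_#|B| -> R) (lambda : 'I_#|C| -> R) := Experiment {
  disp : measure_display;
  sample : measurableType disp;
  prob : probability sample R;
  exc : 'I_#|B| -> int -> {RV prob >-> R};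
  noise : 'I_#|C| -> int -> {RV prob >-> R};
  exc_vec : sample -> int -> 'cV[R]_#|B| := fun o t => \col_i exc i t o;
  noise_vec : sample -> int -> 'cV[R]_#|C| := fun o t => \col_j noise j t o;
  state : sample -> int -> 'cV[R]_n;
  output : sample -> int -> 'cV[R]_#|C|;
  state_eq : forall o t,
    state o t = tf_apply G0 (state o) t + excitation_mx B *m exc_vec o t;
  output_eq : forall o t,
    output o t = measurement_mx C *m state o t + noise_vec o t;
  exc_white : forall i, white_noise (exc i) (sigma2 i);
  exc_indep : independent_processes exc;
  noise_white : forall j, white_noise (noise j) (lambda j);
  noise_gauss : forall j, gaussian_process (noise j);
  noise_indep : independent_processes noise;
  exc_noise : forall i j, uncorrelated_processes (exc i) (noise j)
}.

Section Covariance.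
Context (p n : nat) (G : 'rV[R]_p.+1 -> 'M[{poly R}]_n) (theta0 : 'rV[R]_p.+1)
  (B C : {set 'I_n}) (sigma2 : 'I_#|B| -> R) (lambda : 'I_#|C| -> R)
  (E : experiment (G theta0) sigma2 lambda).

Definition prediction (theta : 'rV[R]_p.+1) (o : sample E) (t : int) :
    'cV[R]_#|C| :=
  tf_apply (predictor_tf (G theta) B C) (exc_vec o) t.

Definition psi (o : sample E) (t : int) : 'M[R]_(p.+1, #|C|) :=
  \matrix_(k, j)
    'D_(delta_mx 0 k) (fun theta => prediction theta o t j 0) theta0.

Definition noise_cov : 'M[R]_#|C| := diag_mx (\row_j lambda j).

Definition information (t : int) : 'M[R]_p.+1 :=
  \matrix_(k, l) fine ('E_(prob E)[fun o =>
    (psi o t *m invmx noise_cov *m (psi o t)^T) k l])%E.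

Definition asymptotic_cov (t : int) : 'M[R]_p.+1 := invmx (information t).

End Covariance.

(* 0-based: theta 0 0, theta 0 1, theta 0 2 are a_21, a_32, a_43. *)
Definition branch_mx (theta : 'rV[R]_3) : 'M[R]_4 :=
  \matrix_(i, j) if i == j.+1 :> nat then theta 0 (inord j) else 0.

Definition branch_tf (theta : 'rV[R]_3) : 'M[{poly R}]_4 :=
  'X *: map_mx polyC (branch_mx theta).

Lemma branch_tf_unit (theta : 'rV[R]_3) : 1%:M - branch_tf theta \in unitmx.
Proof.
rewrite unitmxE det_trig.
  rewrite big1 ?unitr1// => i _.
  by rewrite !mxE eqxx ltn_eqF// polyC0 mulr0 subr0.
apply/is_trig_mxP => i j ij.
by rewrite !mxE -val_eqE /= (ltn_eqF ij) (ltn_eqF (ltnW _))// polyC0 mulr0 subr0.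
Qed.

End Networks.

(* Nodes are numbered from 1 to 4. *)
Definition node (k : nat) : 'I_4 := inord k.-1.

Definition pattern1_B : {set 'I_4} := [set node 1; node 3]%SET.
Definition pattern1_C : {set 'I_4} := [set node 2; node 4]%SET.
Definition pattern2_B : {set 'I_4} := [set node 1; node 2]%SET.
Definition pattern2_C : {set 'I_4} := [set node 3; node 4]%SET.
Definition pattern3_B : {set 'I_4} := [set node 1; node 2; node 3]%SET.
Definition pattern3_C : {set 'I_4} := [set node 4]%SET.
Definition pattern4_B : {set 'I_4} := [set node 1]%SET.
Definition pattern4_C : {set 'I_4} := [set node 2; node 3; node 4]%SET.

(* An experiment on the uniformly excited branch with equal parameters. *)
Definition uniform_experiment (R : realType) (a sigma2 lambda : R)
    (B C : {set 'I_4}) : Type :=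
  @experiment R 4 (branch_tf (const_mx a)) B C (fun=> sigma2) (fun=> lambda).

Definition branch_cov (R : realType) (a sigma2 lambda : R) (B C : {set 'I_4})
    (E : uniform_experiment a sigma2 lambda B C) (t : int) : 'M[R]_3 :=
  @asymptotic_cov R 2 4 (@branch_tf R) (const_mx a) B C
    (fun=> sigma2) (fun=> lambda) E t.

(* Main.v *)
Require Import Defs.
From HB Require Import structures.
From mathcomp Require Import all_boot all_order all_algebra.
From mathcomp Require Import all_classical all_reals all_analysis.
From mathcomp Require Import measurable_realfun ring lra.

Set Implicit Arguments.
Unset Strict Implicit.
Unset Printing Implicit Defensive.

Import Order.TTheory GRing.Theory Num.Theory.
Import numFieldNormedType.Exports.
Local Open Scope ring_scope.
Local Open Scope classical_set_scope.

(** The output at node j is a sum over the excited nodes i <= j of the delayed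
excitation r_i (t - (j - i)) times the product of the parameters along the path
from i to j.  The derivative of the predictor in one parameter of that path is
the product of the other ones, so with all parameters equal to a the path
contributes a vector that is a ^ (j - i - 1) on its edges and 0 elsewhere.  Two
different excitations are independent with mean zero, so distinct paths that
end at the same output do not interact, and the information matrix
([informationE], [uniform_informationE]) is sigma2 / lambda times the sum, over
all pairs of an excited and a measured node, of the rank-one matrices of the
path vectors.

With s = a ^ 2 the four sums are explicit 3 x 3 matrices with explicit inverses,
and up to the common factor lambda / sigma2 the traces of the covariances are
- (I) 4 + 1 / s ^ 2,
- (II) 2 / s + (1 + 2 s) / (1 + s) ^ 2,
- (III) and (IV) 2 + 2 / s + 1 / s ^ 2.
Since (1 + 2 s) / (1 + s) ^ 2 < 1, pattern (II) is below (III) and (IV), and it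
is below (I) because 4 + 1 / s ^ 2 - 2 / s = 3 + (1 / s - 1) ^ 2.

The probabilistic input is that the cross moments of independent zero-mean
processes vanish ([white_noise_cross_moment]).  Independence is given on events,
so it is first turned into a product law for the pair, to which Fubini's theorem
applies ([integral_independent_pair], [independent_expectationM]). *)

(** * Expectation of a product of independent variables *)

Section IndependentPair.
Local Open Scope ereal_scope.
Context d (T : measurableType d) (R : realType) (P : probability T R).

Definition independent_pair d1 d2 (T1 : measurableType d1)
    (T2 : measurableType d2) (X : T -> T1) (Y : T -> T2) : Prop :=
  forall A B, measurable A -> measurable B ->
    P (X @^-1` A `&` Y @^-1` B) = P (X @^-1` A) * P (Y @^-1` B).

Section JointLaw.
Context d1 d2 (T1 : measurableType d1) (T2 : measurableType d2).
Variables (X : {mfun T >-> T1}) (Y : {mfun T >-> T2}).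

Let XY o := (X o, Y o).

Let measurable_XY : measurable_fun [set: T] XY.
Proof. exact: measurable_fun_pair. Qed.

HB.instance Definition _ := isMeasurableFun.Build _ _ _ _ XY measurable_XY.

(** The joint law agrees with the product of the two laws on rectangles, hence
on all measurable sets, and Fubini's theorem applies to the product. *)
Lemma integral_independent_pair (f : T1 * T2 -> \bar R) :
  independent_pair X Y -> measurable_fun [set: T1 * T2] f ->
  P.-integrable [set: T] (fun o => f (X o, Y o)) ->
  \int[P]_o f (X o, Y o) =
    \int[distribution P X]_x \int[distribution P Y]_y f (x, y).
Proof.
move=> indep mf intf.
have jointE (A : set (T1 * T2)) : measurable A ->
    (distribution P X \x distribution P Y) A = distribution P XY A.
  by apply: product_measure_unique => B C mB mC; rewrite /= -indep.
have intfXY : (distribution P XY).-integrable [set: T1 * T2] f.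
  exact: integrable_pushforward.
rewrite integral12_prod_meas1.
  rewrite (eq_measure_integral (distribution P XY)); last first.
    by move=> A mA _; exact: jointE.
  by rewrite integral_pushforward.
have /integrableP[_ fXY] := intfXY.
apply/integrableP; split => //.
rewrite (eq_measure_integral (distribution P XY))// => A mA _.
exact: jointE.
Qed.

End JointLaw.

(** Fubini's theorem needs X Y to be integrable, which follows from the square
integrability of X and Y. *)
Lemma independent_expectationM (X Y : {RV P >-> R}) :
  independent_pair X Y ->
  (X : T -> R) \in Lfun P 2%:E -> (Y : T -> R) \in Lfun P 2%:E ->
  'E_P[X \* Y] = 'E_P[X] * 'E_P[Y].
Proof.
move=> indep X2 Y2.
have Pfin : P [set: T] \is a fin_num by rewrite fin_num_measure.
have /Lfun1_integrable iX : (X : T -> R) \in Lfun P 1 by exact: Lfun_subset12.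
have /Lfun1_integrable iY : (Y : T -> R) \in Lfun P 1 by exact: Lfun_subset12.
have /Lfun1_integrable iXY := Lfun2_mul_Lfun1 X2 Y2.
have idE (Z : {RV P >-> R}) : P.-integrable [set: T] (EFin \o Z) ->
  \int[distribution P Z]_z z%:E = 'E_P[Z].
  by move=> iZ; rewrite integral_distribution// unlock.
have iLaw (Z : {RV P >-> R}) : P.-integrable [set: T] (EFin \o Z) ->
    (distribution P Z).-integrable [set: R] EFin.
  by move=> iZ; exact: integrable_pushforward.
transitivity (\int[P]_o (X o * Y o)%:E); first by rewrite unlock.
rewrite (@integral_independent_pair _ _ _ _ X Y (fun z => (z.1 * z.2)%:E))//;
  last first.
  by apply/measurable_EFinP; exact: measurable_funM.
transitivity (\int[distribution P X]_x (x%:E * 'E_P[Y])).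
  apply: eq_integral => x _ /=; under eq_integral do rewrite EFinM.
  by rewrite integralZl ?iLaw// idE.
rewrite -(@fineK _ 'E_P[Y]) ?expectation_fin_num//; last exact/Lfun1_integrable.
by rewrite integralZr ?iLaw// idE.
Qed.

Lemma finite_second_moment_Lfun2 (X : {RV P >-> R}) :
  'E_P[X \* X] \is a fin_num -> (X : T -> R) \in Lfun P 2%:E.
Proof.
move=> fin; rewrite inE; apply/andP; split; rewrite inE/=.
  exact: measurable_funP.
rewrite /finite_norm; apply: (@lty_poweRy _ _ 2) => //.
rewrite powR_Lnorm//.
rewrite ge0_fin_numE in fin; last first.
  by apply: expectation_ge0 => o; rewrite /= -expr2 sqr_ge0.
rewrite unlock in fin.
under eq_integral => o _.
  rewrite abse_EFin poweR_EFin powR_mulrn// -normrX ger0_norm ?sqr_ge0//.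
  rewrite expr2; over.
by [].
Qed.

End IndependentPair.

(** * Moments of white noise *)

Section WhiteNoise.
Context d (T : measurableType d) (R : realType) (P : probability T R).

Lemma white_noise_second_moment (X : int -> {RV P >-> R}) v t :
  white_noise X v -> ('E_P[X t \* X t] = v%:E)%E.
Proof.
move=> [X0 Xv _]; rewrite -(Xv t) /variance.
rewrite [in RHS]unlock X0 /=; congr expectation.
by apply/funext => o; rewrite !fctE /= subr0.
Qed.

(** As the mean is 0, the variance is the integral of the square; its being
finite is membership in L2. *)
Lemma white_noise_Lfun2 (X : int -> {RV P >-> R}) v t :
  white_noise X v -> (X t : T -> R) \in Lfun P 2%:E.
Proof.
by move=> /white_noise_second_moment XX; apply: finite_second_moment_Lfun2;
  rewrite XX.
Qed.

(** In the product rule over all processes, every process other than i and j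
takes the sure event. *)
Lemma independent_processes_pair (I : finType) (X : I -> int -> {RV P >-> R})
    (i j : I) (t s : int) :
  independent_processes X -> i != j -> independent_pair P (X i t) (X j s).
Proof.
move=> indep ij A B mA mB.
have ev k u D : measurable D -> process_events (X k) (X k u @^-1` D).
  move=> mD; apply: sub_sigma_algebra; exists u => //=.
  by exists D; rewrite ?setTI.
pose F k : set T := if k == i then X i t @^-1` A
  else if k == j then X j s @^-1` B else setT.
have /indep : forall k, process_events (X k) (F k).
  move=> k; rewrite /F; case: eqVneq => [->|_]; first exact: ev.
  case: eqVneq => [->|_]; first exact: ev.
  by have := ev k 0 setT measurableT; rewrite preimage_setT.
have -> : \bigcap_k F k = X i t @^-1` A `&` X j s @^-1` B.
  apply/seteqP; split => o.
    move=> Fo; split; first by have := Fo i Logic.I; rewrite /F eqxx.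
    by have := Fo j Logic.I; rewrite /F eq_sym (negbTE ij) eqxx.
  by move=> [Ao Bo] k _; rewrite /F; case: eqP => // _; case: eqP.
move=> ->; rewrite (bigD1 i)//= (bigD1 j) 1?eq_sym//= big1 => [|k].
  by rewrite mule1 /F !eqxx eq_sym (negbTE ij).
by rewrite /F => /andP[/negbTE -> /negbTE ->]; rewrite probability_setT.
Qed.

(** The sampling time depends on the process only, so the diagonal case i = j is
a variance; this is the situation of the paths that end at one output. *)
Lemma white_noise_cross_moment (I : finType) (X : I -> int -> {RV P >-> R})
    (v : I -> R) (i j : I) (t : I -> int) :
  (forall i, white_noise (X i) (v i)) -> independent_processes X ->
  ('E_P[X i (t i) \* X j (t j)] = (if i == j then v i else 0)%:E)%E.
Proof.
move=> Xw indep; case: eqVneq => [<-|ij].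
  exact: white_noise_second_moment.
rewrite independent_expectationM//.
- by have [-> _ _] := Xw i; rewrite mul0e.
- exact: independent_processes_pair.
- exact: white_noise_Lfun2 (Xw i).
- exact: white_noise_Lfun2 (Xw j).
Qed.

Lemma expectation_lincomb (I : Type) (s : seq I) (c : I -> R)
    (Z : I -> T -> R) : (forall i, Z i \in Lfun P 1) ->
  ('E_P[fun o => \sum_(i <- s) c i * Z i o]%R =
   \sum_(i <- s) (c i)%:E * 'E_P[Z i])%E.
Proof.
move=> Z1; rewrite unlock.
under eq_integral do rewrite -sumEFin.
have iZ i : P.-integrable setT (EFin \o Z i) by exact/Lfun1_integrable.
rewrite integral_sum// => [|i].
  apply: eq_bigr => i _; under eq_integral do rewrite EFinM.
  exact: (integralZl measurableT (iZ i)).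
rewrite (_ : (fun _ => _) = (fun o => (c i)%:E * (EFin \o Z i) o)%E)//.
exact: integrableZl.
Qed.

End WhiteNoise.

(** * The predictor of a branch and its information matrix *)

Section BranchPredictor.
Context (R : realType).
Implicit Types (theta : 'rV[R]_3) (b c : nat).

(** The static gain from node b to node c: the empty product 1 when b = c, and 0
when c is upstream of b. *)
Definition path_gain theta b c : R :=
  if (b <= c)%N then \prod_(b <= m < c) theta 0 (inord m) else 0.

(** Row i of (1 - G) W subtracts from row i of W the row above it, multiplied by
the parameter and the delay of the edge into i; this leaves the identity because
a path that ends at i is a path that ends at its predecessor, plus one edge. *)
Lemma branch_transferE theta :
  invmx (1%:M - branch_tf theta) =
  \matrix_(i, j) ((path_gain theta j i)%:P * 'X^(i - j)).
Proof.
set W := (RHS); suff W1 : (1%:M - branch_tf theta) *m W = 1%:M.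
  have tfU := branch_tf_unit theta.
  by apply: (can_inj (mulKmx tfU)); rewrite mulmxV.
rewrite mulmxBl mul1mx; apply/matrixP => i j; rewrite !mxE.
(* The first node has no predecessor: only the path of length 0 ends there. *)
case: i j => [] [|i] lti [j ltj].
  rewrite big1 ?subr0 => [|k _]; last by rewrite !mxE /= polyC0 mulr0 mul0r.
  rewrite /path_gain -val_eqE; case: j ltj => [|j] ltj /=.
    by rewrite big_nil mulr1.
  by rewrite polyC0 mul0r.
rewrite (bigD1 (Ordinal (ltnW lti)))//= big1 ?addr0 => [|k ki]; last first.
  rewrite !mxE /= eqSS eq_sym ifN; first by rewrite polyC0 mulr0 mul0r.
  by move: ki; rewrite -val_eqE.
rewrite !mxE /= eqxx /path_gain -val_eqE /=.
have [ji|ij] := leqP j i.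
  rewrite leqW// big_nat_recr//= gtn_eqF ?ltnS// subSn// exprS polyCM mulr0n.
  by ring.
rewrite polyC0 mul0r mulr0 subr0 leq_eqVlt ltnS leqNgt ij orbF.
rewrite [j == _]eq_sym; case: eqVneq => [<-|_]; last by rewrite polyC0 mul0r.
by rewrite big_geq// subnn mulr1.
Qed.

Lemma predictor_tfE n (G : 'M[{poly R}]_n) (B C : {set 'I_n}) j k :
  predictor_tf G B C j k = invmx (1%:M - G) (enum_val j) (enum_val k).
Proof.
rewrite !mxE (bigD1 (enum_val k))//= big1 ?addr0 => [|l /negbTE lk]; last first.
  by rewrite !mxE lk mulr0.
rewrite !mxE eqxx mulr1 (bigD1 (enum_val j))//= big1 ?addr0.
  by rewrite !mxE eqxx mul1r.
by move=> l /negbTE lj; rewrite !mxE lj mul0r.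
Qed.

(** The sum runs up to the size of the polynomial, which is 0 instead of L + 1
when g = 0; the result is g f(L) in both cases. *)
Lemma sum_coef_monomial (g : R) (L : nat) (f : nat -> R) :
  \sum_(l < size (g%:P * 'X^L)) (g%:P * 'X^L)`_l * f l = g * f L.
Proof.
have [->|g0] := eqVneq g 0.
  by rewrite polyC0 !mul0r size_poly0 big_ord0.
rewrite size_mulXn ?polyC_eq0// size_polyC g0 addn1 big_ord_recr /=.
rewrite big1 => [|l _]; last first.
  by rewrite coefCM coefXn ltn_eqF// mulr0 mul0r.
by rewrite add0r coefCM coefXn eqxx mulr1.
Qed.

(** The partial derivative of [path_gain] in parameter k. *)
Definition path_sensitivity theta b c (k : nat) : R :=
  if (b <= k < c)%N then \prod_(b <= m < c | m != k) theta 0 (inord m) else 0.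

(** A path uses each edge once, so its gain is affine in each parameter, with
slope the product of the other parameters. The bound on c keeps the indices of
the edges below 3, where [inord] is faithful. *)
Lemma path_gain_shift theta b c (k : 'I_3) (h : R) : (c <= 3)%N ->
  path_gain (h *: delta_mx 0 k + theta) b c =
  path_gain theta b c + h * path_sensitivity theta b c k.
Proof.
move=> c3; rewrite /path_gain /path_sensitivity.
have [bc|cb] := leqP b c; last first.
  rewrite ifN ?mulr0 ?addr0//; apply: contraTN cb => /andP[bk kc].
  by rewrite -leqNgt (leq_trans bk)// ltnW.
have E m : (b <= m < c)%N ->
    (h *: delta_mx 0 k + theta) 0 (inord m) =
    h * (m == k)%:R + theta 0 (inord m).
  move=> /andP[_ mc]; rewrite !mxE eqxx /= -val_eqE /= inordK//.
  exact: leq_trans c3.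
case: ifPn => bkc; last first.
  rewrite mulr0 addr0; apply: eq_big_nat => m bmc.
  rewrite E// (_ : m == k = false) ?mulr0 ?add0r//.
  by apply: contraNF bkc => /eqP <-.
have kin : (k : nat) \in index_iota b c by rewrite mem_index_iota.
rewrite !(bigD1_seq (k : nat) kin) ?iota_uniq//=.
rewrite [in LHS]big_nat_cond [in LHS](eq_bigr (fun m => theta 0 (inord m))).
  by rewrite -big_nat_cond E// eqxx mulr1; ring.
by move=> m /andP[bmc /negbTE mk]; rewrite E// mk mulr0 add0r.
Qed.

(** The difference quotient is constant. *)
Lemma derive_affine (V : normedModType R) (f : V -> R) (x v : V) (g : R) :
  (forall h : R, f (h *: v + x) = f x + h * g) -> 'D_v f x = g.
Proof.
move=> fE; rewrite /derive; apply: lim_near_cst => //.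
near=> h; rewrite /= fE addrC addKr /GRing.scale /= mulKf//.
by near: h; exact: nbhs_dnbhs_neq.
Unshelve. all: by end_near. Qed.

Lemma invmx_diag n (v : 'rV[R]_n) : (forall i, v 0 i != 0) ->
  invmx (diag_mx v) = diag_mx (\row_i (v 0 i)^-1).
Proof.
move=> v0.
have dv : diag_mx v *m diag_mx (\row_i (v 0 i)^-1) = 1%:M.
  apply/matrixP => i j; rewrite mul_diag_mx !mxE; case: eqVneq => [->|_].
    by rewrite mulfV.
  by rewrite mulr0n mulr0.
have /mulmx1_unit[vU _] := dv.
by apply: (can_inj (mulKmx vU)); rewrite mulmxV.
Qed.

Section Information.
Context (theta0 : 'rV[R]_3) (B C : {set 'I_4}) (sigma2 : 'I_#|B| -> R)
  (lambda : 'I_#|C| -> R) (E : experiment (branch_tf theta0) sigma2 lambda).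

Definition path_delay (i : 'I_#|B|) (j : 'I_#|C|) : int :=
  ((enum_val j - enum_val i)%N)%:Z.

Lemma predictionE theta (o : sample E) t j :
  prediction (G := @branch_tf R) (E := E) theta o t j 0 =
  \sum_(i < #|B|) path_gain theta (enum_val i) (enum_val j)
    * exc E i (t - path_delay i j) o.
Proof.
rewrite /prediction /tf_apply mxE; apply: eq_bigr => i _.
rewrite predictor_tfE branch_transferE mxE.
rewrite (sum_coef_monomial _ _ (fun l => exc_vec o (t - l%:Z) i 0)).
by rewrite /exc_vec mxE.
Qed.

Lemma psiE (o : sample E) t k j :
  psi (G := @branch_tf R) (E := E) o t k j =
  \sum_(i < #|B|) path_sensitivity theta0 (enum_val i) (enum_val j) k
    * exc E i (t - path_delay i j) o.
Proof.
rewrite mxE; apply: derive_affine => h; rewrite !predictionE.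
rewrite mulr_sumr -big_split; apply: eq_bigr => i _ /=.
rewrite path_gain_shift; first by ring.
by rewrite -ltnS ltn_ord.
Qed.

(** An entry is the mean of a sum over outputs j and pairs (i, i') of
excitations. The terms with i <> i' vanish, and those with i = i' carry the
variance of excitation i, the same delayed sample occurring in both factors. *)
Lemma informationE t k l : (forall j, lambda j != 0) ->
  information (G := @branch_tf R) E t k l =
  \sum_(j < #|C|) \sum_(i < #|B|) sigma2 i / lambda j
    * (path_sensitivity theta0 (enum_val i) (enum_val j) k
       * path_sensitivity theta0 (enum_val i) (enum_val j) l).
Proof.
move=> lambda0.
pose s (i : 'I_#|B|) (j : 'I_#|C|) (m : nat) :=
  path_sensitivity theta0 (enum_val i) (enum_val j) m.
pose c (p : 'I_#|C| * ('I_#|B| * 'I_#|B|)) :=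
  (lambda p.1)^-1 * (s p.2.1 p.1 k * s p.2.2 p.1 l).
pose Z (p : 'I_#|C| * ('I_#|B| * 'I_#|B|)) (o : sample E) : R :=
  exc E p.2.1 (t - path_delay p.2.1 p.1) o
  * exc E p.2.2 (t - path_delay p.2.2 p.1) o.
have quadE o : (psi (G := @branch_tf R) (E := E) o t *m invmx (noise_cov lambda)
    *m (psi (G := @branch_tf R) (E := E) o t)^T) k l = \sum_p c p * Z p o.
  rewrite -(pair_bigA _ (fun j p => c (j, p) * Z (j, p) o)) mxE.
  apply: eq_bigr => j _.
  rewrite invmx_diag => [|i]; last by rewrite mxE.
  rewrite mul_mx_diag !mxE.
  have psiEm m : psi (G := @branch_tf R) (E := E) o t m j =
      \sum_(i < #|B|) s i j m * exc E i (t - path_delay i j) o by exact: psiE.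
  move: (psiEm k) (psiEm l); rewrite !mxE => -> ->.
  rewrite -(pair_bigA _ (fun i i' => c (j, (i, i')) * Z (j, (i, i')) o)).
  rewrite !mulr_suml; apply: eq_bigr => i _; rewrite mulr_sumr.
  by apply: eq_bigr => i' _; rewrite /c /Z /=; ring.
have excW i : white_noise (exc E i) (sigma2 i) by exact: exc_white.
have excI : independent_processes (exc E) by exact: exc_indep.
rewrite mxE (_ : (fun o => _) = (fun o => \sum_p c p * Z p o)); last first.
  by apply/funext => o; rewrite quadE.
rewrite expectation_lincomb => [|p]; last first.
  by apply: Lfun2_mul_Lfun1; apply: white_noise_Lfun2; exact: excW.
under eq_bigr => p _.
  rewrite (white_noise_cross_moment _ _ (fun i => t - path_delay i p.1)
    excW excI) -EFinM; over.
rewrite sumEFin /=.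
rewrite -(pair_bigA _ (fun j p =>
  c (j, p) * (if p.1 == p.2 then sigma2 p.1 else 0))).
apply: eq_bigr => j _.
rewrite -(pair_bigA _ (fun i i' =>
  c (j, (i, i')) * (if i == i' then sigma2 i else 0))).
apply: eq_bigr => i _ /=.
rewrite (bigD1 i)//= big1 ?addr0 => [|i' /negbTE i'i].
  by rewrite eqxx /c /s /=; ring.
by rewrite eq_sym i'i mulr0.
Qed.

End Information.
End BranchPredictor.

(** * The four excitation and measurement patterns *)

Section Patterns.
Context (R : realType).
Implicit Types (a s : R) (B C : {set 'I_4}).

(** One of the c - b edges of the path is left out of the product. *)
Lemma path_sensitivity_const a b c k :
  path_sensitivity (const_mx a) b c k =
  if (b <= k < c)%N then a ^+ (c - b).-1 else 0.
Proof.
rewrite /path_sensitivity; case: ifPn => // bkc.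
under eq_bigr do rewrite mxE.
rewrite big_const_seq iter_mulr_1; congr (_ ^+ _).
rewrite (eq_count (a2 := predC (pred1 k)))// -(size_iota b (c - b)).
rewrite -[size _](count_predC (pred1 k)) count_uniq_mem ?iota_uniq//.
by rewrite mem_index_iota bkc.
Qed.

Definition mx3 (rows : seq (seq R)) : 'M[R]_3 :=
  \matrix_(i, j) nth 0 (nth [::] rows i) j.

Definition path_information a B C : 'M[R]_3 :=
  \matrix_(k, l) \sum_(j in C) \sum_(i in B)
    path_sensitivity (const_mx a) i j k * path_sensitivity (const_mx a) i j l.

Lemma uniform_informationE a sigma2 lambda B C
    (E : uniform_experiment a sigma2 lambda B C) t : lambda != 0 ->
  information (G := @branch_tf R) E t =
  (sigma2 / lambda) *: path_information a B C.
Proof.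
move=> lambda0; apply/matrixP => k l; rewrite informationE// !mxE.
rewrite [in RHS]big_enum_val mulr_sumr; apply: eq_bigr => j _.
by rewrite [in RHS]big_enum_val mulr_sumr.
Qed.

(** A right inverse of a square matrix is its inverse, so exhibiting N settles
the covariance. *)
Lemma tr_branch_cov a sigma2 lambda B C
    (E : uniform_experiment a sigma2 lambda B C) t (M N : 'M[R]_3) :
  sigma2 != 0 -> lambda != 0 -> path_information a B C = M -> M *m N = 1%:M ->
  \tr (branch_cov E t) = lambda / sigma2 * \tr N.
Proof.
move=> s0 l0 infM MN.
have sl0 : sigma2 / lambda != 0 by rewrite mulf_neq0// invr_eq0.
have infN : ((sigma2 / lambda) *: M) *m ((lambda / sigma2) *: N) = 1%:M.
  rewrite -scalemxAl -scalemxAr scalerA MN.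
  by rewrite -[lambda / _]invf_div mulfV// scale1r.
have [infU _] := mulmx1_unit infN.
rewrite -mxtraceZ; congr (\tr _).
rewrite /branch_cov /asymptotic_cov uniform_informationE// infM.
by apply: (can_inj (mulKmx infU)); rewrite mulmxV.
Qed.

Lemma sum_nodes (A : {set 'I_4}) (F : 'I_4 -> R) :
  \sum_(i in A) F i =
  \sum_(0 <= m < 4) (if inord m \in A then F (inord m) else 0).
Proof.
by rewrite big_mkord big_mkcond; under [RHS]eq_bigr do rewrite inord_val.
Qed.

Lemma node_inord (m k : nat) : (m < 4)%N -> (0 < k <= 4)%N ->
  (inord m == node k) = (m.+1 == k).
Proof.
move=> m4; case: k => // k /= k4.
by rewrite /node -val_eqE /= !inordK.
Qed.

Let sumE := (sum_nodes, big_nat_recl, big_geq, inE, node_inord, inordK).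

(** The paths of this pattern are 1-2, 3-4 and 1-2-3-4. *)
Lemma pattern1_information a (s := a ^+ 2) :
  path_information a pattern1_B pattern1_C =
  mx3 [:: [:: 1 + s ^+ 2; s ^+ 2; s ^+ 2];
          [:: s ^+ 2; s ^+ 2; s ^+ 2];
          [:: s ^+ 2; s ^+ 2; 1 + s ^+ 2]].
Proof.
apply/matrixP => k l; rewrite !mxE !sumE//= !path_sensitivity_const.
by case: k => [[|[|[|//]]] ltk]; case: l => [[|[|[|//]]] ltl] /=;
  rewrite /s; ring.
Qed.

(** The paths of this pattern are 1-2-3, 1-2-3-4, 2-3 and 2-3-4: one more than
there are parameters. *)
Lemma pattern2_information a (s := a ^+ 2) :
  path_information a pattern2_B pattern2_C =
  mx3 [:: [:: s + s ^+ 2; s + s ^+ 2; s ^+ 2];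
          [:: s + s ^+ 2; (1 + s) ^+ 2; s + s ^+ 2];
          [:: s ^+ 2; s + s ^+ 2; s + s ^+ 2]].
Proof.
apply/matrixP => k l; rewrite !mxE !sumE//= !path_sensitivity_const.
by case: k => [[|[|[|//]]] ltk]; case: l => [[|[|[|//]]] ltl] /=;
  rewrite /s; ring.
Qed.

(** The paths of this pattern are 1-2-3-4, 2-3-4 and 3-4. *)
Lemma pattern3_information a (s := a ^+ 2) :
  path_information a pattern3_B pattern3_C =
  mx3 [:: [:: s ^+ 2; s ^+ 2; s ^+ 2];
          [:: s ^+ 2; s + s ^+ 2; s + s ^+ 2];
          [:: s ^+ 2; s + s ^+ 2; 1 + s + s ^+ 2]].
Proof.
apply/matrixP => k l; rewrite !mxE !sumE//= !path_sensitivity_const.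
by case: k => [[|[|[|//]]] ltk]; case: l => [[|[|[|//]]] ltl] /=;
  rewrite /s; ring.
Qed.

(** The paths of this pattern are 1-2, 1-2-3 and 1-2-3-4. *)
Lemma pattern4_information a (s := a ^+ 2) :
  path_information a pattern4_B pattern4_C =
  mx3 [:: [:: 1 + s + s ^+ 2; s + s ^+ 2; s ^+ 2];
          [:: s + s ^+ 2; s + s ^+ 2; s ^+ 2];
          [:: s ^+ 2; s ^+ 2; s ^+ 2]].
Proof.
apply/matrixP => k l; rewrite !mxE !sumE//= !path_sensitivity_const.
by case: k => [[|[|[|//]]] ltk]; case: l => [[|[|[|//]]] ltl] /=;
  rewrite /s; ring.
Qed.

Let tr_mx3 rows : \tr (mx3 rows) =
  (nth [::] rows 0)`_0 + (nth [::] rows 1)`_1 + (nth [::] rows 2)`_2.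
Proof. by rewrite /mxtrace !big_ord_recl big_ord0 !mxE /= addr0 addrA. Qed.

Section Traces.
Context (a sigma2 lambda : R).
Hypotheses (a_neq0 : a != 0) (sigma2_neq0 : sigma2 != 0)
  (lambda_neq0 : lambda != 0).
Local Notation s := (a ^+ 2).

Let s1_neq0 : 1 + s != 0.
Proof. by rewrite gt_eqF// ltr_wpDr ?sqr_ge0. Qed.

Lemma tr_pattern1
    (E : uniform_experiment a sigma2 lambda pattern1_B pattern1_C) t :
  \tr (branch_cov E t) = lambda / sigma2 * (4 + s ^- 2).
Proof.
pose N := mx3 [:: [:: 1; -1; 0];
         [:: -1; 2 + s ^- 2; -1];
         [:: 0; -1; 1]].
rewrite (tr_branch_cov E t sigma2_neq0 lambda_neq0 (pattern1_information a)
  (N := N)).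
  by rewrite tr_mx3 /=; congr (_ * _); field; rewrite ?a_neq0 ?s1_neq0.
apply/matrixP => k l; rewrite !mxE !big_ord_recl big_ord0 !mxE.
by case: k => [[|[|[|//]]] ltk]; case: l => [[|[|[|//]]] ltl] /=;
  field; rewrite ?a_neq0 ?s1_neq0.
Qed.

Lemma tr_pattern2
    (E : uniform_experiment a sigma2 lambda pattern2_B pattern2_C) t :
  \tr (branch_cov E t) = lambda / sigma2 * (2 / s + (1 + 2 * s) / (1 + s) ^+ 2).
Proof.
pose N := mx3 [:: [:: s^-1; - (1 + s)^-1; 0];
         [:: - (1 + s)^-1; (1 + 2 * s) / (1 + s) ^+ 2; - (1 + s)^-1];
         [:: 0; - (1 + s)^-1; s^-1]].
rewrite (tr_branch_cov E t sigma2_neq0 lambda_neq0 (pattern2_information a)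
  (N := N)).
  by rewrite tr_mx3 /=; congr (_ * _); field; rewrite ?a_neq0 ?s1_neq0.
apply/matrixP => k l; rewrite !mxE !big_ord_recl big_ord0 !mxE.
by case: k => [[|[|[|//]]] ltk]; case: l => [[|[|[|//]]] ltl] /=;
  field; rewrite ?a_neq0 ?s1_neq0.
Qed.

Lemma tr_pattern3
    (E : uniform_experiment a sigma2 lambda pattern3_B pattern3_C) t :
  \tr (branch_cov E t) = lambda / sigma2 * (2 + 2 / s + s ^- 2).
Proof.
pose N := mx3 [:: [:: s ^- 2 + s^-1; - s^-1; 0];
         [:: - s^-1; s^-1 + 1; -1];
         [:: 0; -1; 1]].
rewrite (tr_branch_cov E t sigma2_neq0 lambda_neq0 (pattern3_information a)
  (N := N)).
  by rewrite tr_mx3 /=; congr (_ * _); field; rewrite ?a_neq0 ?s1_neq0.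
apply/matrixP => k l; rewrite !mxE !big_ord_recl big_ord0 !mxE.
by case: k => [[|[|[|//]]] ltk]; case: l => [[|[|[|//]]] ltl] /=;
  field; rewrite ?a_neq0 ?s1_neq0.
Qed.

Lemma tr_pattern4
    (E : uniform_experiment a sigma2 lambda pattern4_B pattern4_C) t :
  \tr (branch_cov E t) = lambda / sigma2 * (2 + 2 / s + s ^- 2).
Proof.
pose N := mx3 [:: [:: 1; -1; 0];
         [:: -1; 1 + s^-1; - s^-1];
         [:: 0; - s^-1; s^-1 + s ^- 2]].
rewrite (tr_branch_cov E t sigma2_neq0 lambda_neq0 (pattern4_information a)
  (N := N)).
  by rewrite tr_mx3 /=; congr (_ * _); field; rewrite ?a_neq0 ?s1_neq0.
apply/matrixP => k l; rewrite !mxE !big_ord_recl big_ord0 !mxE.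
by case: k => [[|[|[|//]]] ltk]; case: l => [[|[|[|//]]] ltl] /=;
  field; rewrite ?a_neq0 ?s1_neq0.
Qed.

End Traces.
End Patterns.

(** * Comparison of the traces *)

Theorem mainTheorem5 (R : realType) (a sigma2 lambda : R)
  (a_neq0 : a != 0) (sigma2_gt0 : 0 < sigma2) (lambda_gt0 : 0 < lambda)
  (E1 : uniform_experiment a sigma2 lambda pattern1_B pattern1_C)
  (E2 : uniform_experiment a sigma2 lambda pattern2_B pattern2_C)
  (E3 : uniform_experiment a sigma2 lambda pattern3_B pattern3_C)
  (E4 : uniform_experiment a sigma2 lambda pattern4_B pattern4_C)
  (t : int) :
  [/\ \tr (branch_cov E2 t) < \tr (branch_cov E1 t),
      \tr (branch_cov E2 t) < \tr (branch_cov E3 t) &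
      \tr (branch_cov E2 t) < \tr (branch_cov E4 t)].
Proof.
have sigma20 := lt0r_neq0 sigma2_gt0; have lambda0 := lt0r_neq0 lambda_gt0.
rewrite tr_pattern1// tr_pattern2// tr_pattern3// tr_pattern4//.
have c_gt0 : 0 < lambda / sigma2 by rewrite divr_gt0.
rewrite !(ltr_pM2l c_gt0).
set s := a ^+ 2.
have s_gt0 : 0 < s by rewrite exprn_even_gt0.
set r := (1 + 2 * s) / (1 + s) ^+ 2.
(* The difference of the denominator and the numerator is s ^+ 2. *)
have r_lt1 : r < 1.
  by rewrite ltr_pdivrMr ?exprn_gt0 ?addr_gt0// mul1r; nra.
rewrite -[s ^- 2]exprVn; set u := s^-1.
have u_gt0 : 0 < u by rewrite invr_gt0.
(* This square is the margin over pattern (I), up to the constant 3 - r. *)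
have u1_ge0 : 0 <= (u - 1) ^+ 2 by exact: sqr_ge0.
by split; nra.
Qed.
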